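(* Let $m\geq 2$ and let $Y=V(F)\subset\mathbb{P}^2$, $F=F_1\cdots F_m$, be an arrangement of $m$ smooth irreducible curves $V(F_i)$, $i=1,\ldots,m$, that intersect transversely. Let $\beta(J_F)$ be the minimal degree of a syzygy on the Jacobian ideal $J_F$ of $F$, and let $\alpha(\sqrt{J_F})$ be the minimum degree of a generator of $\sqrt{J_F}$. Then $$\alpha(\sqrt{J_F})\leq \beta(J_F)+1.$$
   Context: Let $R=\mathbb{C}[x,y,z]$. The $F_i\in R$ are homogeneous polynomials defining distinct smooth irreducible curves $V(F_i)\subset\mathbb{P}^2$, so $Y$ is a reduced curve. The curves intersect transversely if, whenever $i\neq j$ and $P\in V(F_i)\cap V(F_j)$, the tangent lines to $V(F_i)$ and $V(F_j)$ at $P$ are distinct (more than two of the curves may pass through the same point). $J_F=\langle F_x,F_y,F_z\rangle\subset R$ is the Jacobian ideal, generated by the partial derivatives of $F$. A syzygy of degree $d$ on $J_F$ is a nonzero triple $(A,B,C)$ of homogeneous polynomials of degree $d$ (a zero entry being allowed in any degree) with $AF_x+BF_y+CF_z=0$. The number $\alpha(\sqrt{J_F})$ is the smallest degree of a nonzero homogeneous element of $\sqrt{J_F}$. *)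

(* Defs.v *)
From HB Require Import structures.
From mathcomp Require Import all_boot all_order all_algebra.
From mathcomp Require Import boolp classical_sets reals.
From mathcomp Require Import complex.
From mathcomp Require Import mpoly.

Set Implicit Arguments.
Unset Strict Implicit.
Unset Printing Implicit Defensive.

Import Order.TTheory GRing.Theory Num.Theory.

Local Open Scope classical_set_scope.
Local Open Scope ring_scope.
Local Open Scope complex_scope.

(* The least element of a nonempty set of natural numbers; the default value 0
   for the empty set plays no role, by [syzygy_degrees_neq0] and
   [radical_degrees_neq0] below. *)
Definition least (A : set nat) : nat :=
  xget 0%N [set d | A d /\ forall e, A e -> (d <= e)%N].

Lemma leastP (A : set nat) : A !=set0 ->
  A (least A) /\ forall e, A e -> (least A <= e)%N.
Proof.
case=> d0 Ad0; rewrite /least.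
have exA : exists d, `[< A d >] by exists d0; apply/asboolP.
case: xgetP => [d -> //|none].
case: (ex_minnP exA) => d /asboolP Ad dmin.
by case: (none d); split=> // e Ae; apply: dmin; apply/asboolP.
Qed.

(* Irreducible elements; [irreducible_poly] only covers one variable. *)
Definition irreducible_elt (A : unitRingType) (p : A) : Prop :=
  [/\ p != 0, p \isn't a GRing.unit &
      forall a b, p = a * b -> a \is a GRing.unit \/ b \is a GRing.unit].

Definition homogeneous (n : nat) (A : nzRingType) (p : {mpoly A[n]}) : Prop :=
  exists d : nat, p \is d.-homog.

Definition ideal_span (A : nzRingType) (n : nat) (g : 'I_n -> A) : set A :=
  [set p | exists a : 'I_n -> A, p = \sum_i a i * g i].

Definition radical (A : nzRingType) (I : set A) : set A :=
  [set p | exists n : nat, I (p ^+ n)].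

Section PlaneCurves.
Variable R : realType.

(* A point of P^2 is represented by any of its homogeneous coordinate vectors,
   i.e. by a nonzero P : 'rV[R[i]]_3. *)
Definition zero_locus (G : {mpoly R[i][3]}) : set 'rV[R[i]]_3 :=
  [set P : 'rV[R[i]]_3 | P != 0 /\ G.@[P ord0] = 0].

Definition smooth_curve (G : {mpoly R[i][3]}) : Prop :=
  forall P, zero_locus G P -> exists k, (G^`M(k)).@[P ord0] != 0.

Definition tangent_line (G : {mpoly R[i][3]}) (P : 'rV[R[i]]_3) :
    set 'rV[R[i]]_3 :=
  [set Q : 'rV[R[i]]_3 | Q != 0 /\ \sum_k (G^`M(k)).@[P ord0] * Q ord0 k = 0].

Definition transverse (G H : {mpoly R[i][3]}) : Prop :=
  forall P, zero_locus G P -> zero_locus H P ->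
    tangent_line G P <> tangent_line H P.

Definition jacobian_ideal (F : {mpoly R[i][3]}) : set {mpoly R[i][3]} :=
  ideal_span (fun k : 'I_3 => F^`M(k)).

(* In the library 0 is homogeneous of every degree, so the entries of a syzygy
   may vanish individually. *)
Definition syzygy (F : {mpoly R[i][3]}) (d : nat) (A : 'I_3 -> {mpoly R[i][3]})
    : Prop :=
  [/\ exists k, A k != 0, forall k, A k \is d.-homog &
      \sum_k A k * F^`M(k) = 0].

Definition syzygy_degrees (F : {mpoly R[i][3]}) : set nat :=
  [set d | exists A, syzygy F d A].

Definition beta (F : {mpoly R[i][3]}) : nat := least (syzygy_degrees F).

Definition degrees (I : set {mpoly R[i][3]}) : set nat :=
  [set d | exists G, [/\ I G, G != 0 & G \is d.-homog]].

Definition alpha (I : set {mpoly R[i][3]}) : nat := least (degrees I).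

Lemma dhomog_mderiv (F : {mpoly R[i][3]}) (d : nat) (k : 'I_3) :
  F \is d.-homog -> F^`M(k) \is d.-1.-homog.
Proof.
move=> Fh; apply/dhomogP => m; rewrite mcoeff_msupp mcoeff_deriv => Fm.
have /((elimT (dhomogP _ _ _)) Fh) : (m + U_(k))%MM \in msupp F.
  by rewrite mcoeff_msupp; apply: contraNneq Fm => ->; rewrite mul0rn.
by rewrite /= mdegD mdeg1 addn1 => <-.
Qed.

Lemma mpoly_euler (F : {mpoly R[i][3]}) (d : nat) :
  F \is d.-homog -> \sum_k 'X_k * F^`M(k) = d%:R *: F.
Proof.
move=> Fh; rewrite {2}[F]mpolyE scaler_sumr.
under eq_bigr => k _ do rewrite {1}[F]mpolyE linear_sum mulr_sumr.
rewrite exchange_big /= big_seq [RHS]big_seq; apply: eq_bigr => m mF.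
have <- : mdeg m = d by exact: (elimT (dhomogP _ _ _) Fh).
rewrite mdegE natr_sum scaler_suml; apply: eq_bigr => k _.
rewrite linearZ /= mderivX -!scalerAr scalerA scalerA [X in _ = X *: _]mulrC.
have [->|mk] := eqVneq (m k) 0%N; first by rewrite mulr0 !scale0r.
by rewrite -mpolyXD addmC submK // lep1mP.
Qed.

Lemma syzygy_degrees_neq0 (F : {mpoly R[i][3]}) :
  homogeneous F -> syzygy_degrees F !=set0.
Proof.
case=> d Fh; pose k0 : 'I_3 := ord0; pose k1 : 'I_3 := lift ord0 ord0.
have [F0|F0] := eqVneq (F^`M(k0)) 0.
  exists 0%N, (fun k => if k == k0 then 1 else 0); split.
  - by exists k0; rewrite eqxx oner_neq0.
  - by move=> k; case: ifP => _; rewrite ?dhomog1 ?dhomog0.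
  - rewrite (bigD1 k0) //= F0 mulr0 add0r big1 // => k /negPf ->.
    by rewrite mul0r.
exists d.-1, (fun k => if k == k0 then F^`M(k1)
                       else if k == k1 then - F^`M(k0) else 0); split.
- by exists k1; rewrite /= oppr_eq0.
- move=> k; case: ifP => _; first exact: dhomog_mderiv.
  by case: ifP => _; rewrite ?rpredN ?dhomog0 ?dhomog_mderiv.
- rewrite (bigD1 k0) //= (bigD1 k1) //= big1 => [|k /andP[/negPf -> /negPf ->]].
    by rewrite addr0 mulNr mulrC subrr.
  by rewrite mul0r.
Qed.

Lemma radical_degrees_neq0 (F : {mpoly R[i][3]}) (d : nat) :
  (0 < d)%N -> F != 0 -> F \is d.-homog ->
  degrees (radical (jacobian_ideal F)) !=set0.
Proof.
move=> d0 F0 Fh; exists d, F; split=> //; exists 1%N; rewrite expr1.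
exists (fun k => (d%:R)^-1 *: 'X_k).
under eq_bigr => k _ do rewrite -scalerAl.
by rewrite -scaler_sumr (mpoly_euler Fh) scalerA mulVf ?scale1r // pnatr_eq0 -lt0n.
Qed.

End PlaneCurves.

(* Main.v *)
Require Import Defs.
From HB Require Import structures.
From mathcomp Require Import all_boot all_order all_algebra.
From mathcomp Require Import finmap.
From mathcomp Require Import boolp classical_sets cardinality reals.
From mathcomp Require lebesgue_measure.
From mathcomp Require Import complex.
From mathcomp Require Import mpoly.
From mathcomp Require Import ring.

(** Write [theta] for the derivation [p |-> \sum_k A k * d_k p] attached to a
    syzygy [A] of least degree [d], so that [theta F = 0].  The point is that at
    a singular point [P] of the arrangement the vector [A(P)] is proportional
    to [P].

    Two of the curves, [F_i] and [F_j], meet at [P].  If [theta F_i] and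
    [theta F_j] vanish at [P], then [A(P)] is orthogonal to both gradients; by
    Euler's formula so is [P]; and the gradients are linearly independent by
    transversality.  Hence [A(P)] and [P] lie on one line
    ([common_tangent], [syzygy_at_singular_point]).

    That [theta F_i] vanishes at [P] would follow from [F_i] dividing
    [theta F_i], but a local argument avoids unique factorization
    ([derivation_vanishes]).  Take a line through [P] tangent to [F_i] and, by
    transversality, to no other curve through [P].  If [r] other curves pass
    through [P], then on this line [F_i] vanishes to order at least 2 and
    [\prod_(j != i) F_j] to order exactly [r], while its image under [theta]
    vanishes to order at least [r - 1].  In
    [theta F_i * \prod_(j != i) F_j = - F_i * theta (\prod_(j != i) F_j)]
    the right-hand side has order at least [r + 1], so [theta F_i] vanishes
    at [P].

    Therefore the forms ['X_j * A k - 'X_k * A j], of degree [d + 1], vanish at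
    the common zeros of the Jacobian ideal, and they lie in its radical by the
    Nullstellensatz.  They are not all zero: otherwise
    [A k * (deg F) F = A k * \sum_j 'X_j d_j F = 'X_k * theta F = 0] for
    every [k].

    The Nullstellensatz is proved over an uncountable algebraically closed
    field [K]: if [G] lies in the radical of [I + ('X_k - c)] for every [c] in
    [K], then it lies in the radical of [I] ([radical_adjoin]).  So when [G] is
    outside the radical of [I], one can adjoin some ['X_k - a_k] for every
    variable in turn, which produces a zero [a] of [I] with [G(a) <> 0]. *)

Set Implicit Arguments.
Unset Strict Implicit.
Unset Printing Implicit Defensive.

Import Order.TTheory GRing.Theory Num.Theory.

Local Open Scope classical_set_scope.
Local Open Scope ring_scope.
Local Open Scope complex_scope.

(** * Uncountability of the complex numbers *)

(** A countable set has Lebesgue measure zero, and the line does not. *)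
Lemma real_uncountable (R : realType) : ~ countable [set: R].
Proof.
move=> /lebesgue_measure.countable_lebesgue_measure0.
have -> : [set: R] = [set` (Interval -oo%O +oo%O : interval R)].
  by apply/seteqP; split=> x.
by rewrite lebesgue_measure.lebesgue_measure_itv.
Qed.

Lemma complex_uncountable (R : realType) : ~ countable [set: R[i]].
Proof.
move=> /countable_injP[f f_inj]; apply: (@real_uncountable R).
apply/countable_injP; exists (f \o real_complex R) => x y _ _ /f_inj.
by rewrite !in_setT => /(_ isT isT) [].
Qed.

Lemma uncountable_infinite_fiber (T : Type) (f : T -> nat) :
  ~ countable [set: T] -> exists d, infinite_set [set c | f c = d].
Proof.
move=> T_unc; apply: contrapT => fin; apply: T_unc.
have -> : [set: T] = \bigcup_(d in [set: nat]) [set c | f c = d].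
  by apply/seteqP; split=> // c _; exists (f c).
apply: bigcup_countable => // d _; apply: finite_set_countable.
by apply: contrapT => inf; apply: fin; exists d.
Qed.

(** * Induction and linear dependence for polynomials *)

(** Polynomials are generated as an algebra by constants and variables. *)
Lemma mpoly_algebra_ind (A : comNzRingType) (n : nat)
    (P : {mpoly A[n]} -> Prop) :
  (forall c, P c%:MP) -> (forall i, P 'X_i) ->
  (forall p q, P p -> P q -> P (p + q)) ->
  (forall p q, P p -> P q -> P (p * q)) ->
  forall p, P p.
Proof.
move=> PC PX PD PM; elim/mpolyind=> [|c m p _ _ Pp]; first by rewrite -mpolyC0.
apply: PD => //; rewrite -mul_mpolyC mpolyXE_id; apply: (PM _ _ (PC c)).
apply: big_ind => [|//|i _]; first by rewrite -mpolyC1.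
by elim: (m i) => [|k IH]; rewrite ?expr0 -?mpolyC1 // exprS; apply: PM.
Qed.

(** There are finitely many monomials of degree less than [d], hence more
    polynomials than that of bounded degree are linearly dependent. *)
Lemma mpoly_dependent (K : fieldType) (n d r : nat)
    (u : 'I_r -> {mpoly K[n]}) :
  (forall i, (msize (u i) <= d)%N) -> (#|{: 'X_{1..n < d}}| < r)%N ->
  exists2 v : 'I_r -> K, exists i, v i != 0 & \sum_i v i *: u i = 0.
Proof.
move=> u_small r_large.
pose A := \matrix_(i < r, j < #|{: 'X_{1..n < d}}|) (u i)@_(enum_val j).
have /rowV0Pn[v /sub_kermxP vA v0] : kermx A != 0.
  rewrite -mxrank_eq0 mxrank_ker -lt0n subn_gt0.
  exact: leq_ltn_trans (rank_leq_col A) r_large.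
exists (fun i => v ord0 i).
  apply: contrapT => none; case/eqP: v0; apply/rowP => i; rewrite mxE.
  by apply/eqP; apply: contra_notT none => ?; exists i.
apply/mpolyP => m; rewrite mcoeff0 raddf_sum /=.
have [md|md] := ltnP (mdeg m) d; last first.
  apply: big1 => i _; rewrite mcoeffZ memN_msupp_eq0 ?mulr0 //.
  by apply: msize_mdeg_ge; apply: leq_trans md.
have /rowP/(_ (enum_rank (BMultinom md))) := vA; rewrite !mxE => vAm.
rewrite -[RHS]vAm; apply: eq_bigr => i _.
by rewrite mcoeffZ mxE enum_rankK.
Qed.

(** * Hilbert's Nullstellensatz over an uncountable field *)

Definition is_ideal (A : nzRingType) (I : set A) : Prop :=
  [/\ I 0, forall p q, I p -> I q -> I (p + q) & forall p q, I q -> I (p * q)].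

Definition adjoin (A : nzRingType) (I : set A) (h : A) : set A :=
  [set p | exists u, I (p - u * h)].

Lemma is_ideal_span (A : nzRingType) (n : nat) (g : 'I_n -> A) :
  is_ideal (ideal_span g).
Proof.
split=> [|p q [a ->] [b ->]|p q [a ->]].
- by exists (fun=> 0); rewrite big1 // => i _; rewrite mul0r.
- by exists (fun i => a i + b i); rewrite -big_split; apply: eq_bigr => i _;
    rewrite mulrDl.
- by exists (fun i => p * a i); rewrite mulr_sumr; apply: eq_bigr => i _;
    rewrite mulrA.
Qed.

Lemma is_ideal_adjoin (A : comNzRingType) (I : set A) (h : A) :
  is_ideal I -> is_ideal (adjoin I h).
Proof.
case=> I0 ID IM; split=> [|p q [u Iu] [w Iw]|p q [u Iu]].
- by exists 0; rewrite mul0r subr0.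
- by exists (u + w); rewrite mulrDl opprD addrACA; apply: ID.
- by exists (p * u); rewrite -mulrA -mulrBr; apply: IM.
Qed.

Lemma ideal_sum (A : nzRingType) (I : set A) (T : finType) (f : T -> A) :
  is_ideal I -> (forall i, I (f i)) -> I (\sum_i f i).
Proof. by case=> I0 ID _ If; apply: big_ind. Qed.

Section Nullstellensatz.
Variables (K : closedFieldType) (n : nat).
Hypothesis K_uncountable : ~ countable [set: K].
Implicit Types (I : set {mpoly K[n]}) (G H : {mpoly K[n]}).

(** A nonzero polynomial in ['X_k] alone is a product of factors ['X_k - z],
    and modulo [I] each of these divides a power of [G]. *)
Lemma radical_cancel_poly I (k : 'I_n) G H (p : {poly K}) :
  is_ideal I -> (forall c, radical (adjoin I ('X_k - c%:MP)) G) ->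
  p != 0 -> I (horner_alg 'X_k p * H) -> exists M, I (G ^+ M * H).
Proof.
case=> I0 ID IM Grad; have [r ->] := closed_field_poly_normal p.
rewrite scale_poly_eq0 lead_coef_eq0 => /norP[p0 _].
rewrite linearZ /= mulr_algl -scalerAl -mul_mpolyC => IpH.
have {IpH} : I (horner_alg 'X_k (\prod_(z <- r) ('X - z%:P)) * H).
  have /(IM (lead_coef p)^-1%:MP) := IpH.
  by rewrite mulrA -mpolyCM mulVf ?lead_coef_eq0 // mpolyC1 mul1r.
elim: r H => [|z r IHr] H.
  by rewrite big_nil rmorph1 => IH; exists 0%N; rewrite expr0.
rewrite big_cons rmorphM rmorphB /= horner_algX horner_algC /= => IzH.
have [N [u IGN]] := Grad z.
have [|M IM'] := IHr (G ^+ N * H); last first.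
  by exists (M + N)%N; rewrite exprD -mulrA.
move: IzH IGN; rewrite -mul_mpolyC mulr1.
set q := horner_alg _ _; set x := 'X_k - _ => IzH IGN.
rewrite (_ : q * _ = q * H * (G ^+ N - u * x) + u * (x * q * H)); last by ring.
by apply: ID; apply: IM.
Qed.

(** For every [c] there are [N_c] and [u_c] with
    [G ^+ N_c = u_c * ('X_k - c)] modulo [I].  As [K] is uncountable, infinitely
    many [c] share the same [N = N_c] and the same bound on the degree of [u_c],
    so some of these [u_c] satisfy a linear relation [\sum_c v_c u_c = 0].
    Multiplying it by the product of all ['X_k - c] gives [q('X_k) * G ^+ N] in
    [I], where [q] is nonzero by Lagrange interpolation. *)
Lemma radical_adjoin I (k : 'I_n) G : is_ideal I ->
  (forall c, radical (adjoin I ('X_k - c%:MP)) G) -> radical I G.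
Proof.
move=> idI Grad; have [I0 ID IM] := idI.
have /choice[w wP] (c : K) : exists w : nat * {mpoly K[n]},
    I (G ^+ w.1 - w.2 * ('X_k - c%:MP)).
  by have [N [u Iu]] := Grad c; exists (N, u).
have [d inf_d] := uncountable_infinite_fiber
  (fun c => choice.pickle ((w c).1, msize (w c).2)) K_uncountable.
have [c0 c0d] := infinite_setN0 inf_d.
set N := (w c0).1; set D := msize (w c0).2.
have [B Bd Bcard] := infinite_set_fset #|{: 'X_{1..n < D}}|.+1 inf_d.
pose c (i : 'I_(size B)) := nth 0 B i.
have c_inj i j : i != j -> c i - c j != 0.
  by move=> ij; rewrite subr_eq0 nth_uniq ?fset_uniq.
have wB i : (w (c i)).1 = N /\ msize (w (c i)).2 = D.
  have /Bd /= : c i \in B by apply: mem_nth.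
  by rewrite -c0d => /(pcan_inj choice.pickleK) [].
have [|//|v [i0 vi0] uv] := @mpoly_dependent K n D (size B)
  (fun i => (w (c i)).2).
  by move=> i; case: (wB i) => _ ->.
(* The Lagrange polynomial [L i] vanishes at every [c j] but [c i]. *)
pose L i : {poly K} := \prod_(j | j != i) ('X - (c j)%:P).
pose q : {poly K} := \sum_i v i *: L i.
have L_nz i : (L i).[c i] != 0.
  rewrite horner_prod; apply/prodf_neq0 => j ji.
  by rewrite hornerXsubC c_inj // eq_sym.
have q0 : q != 0.
  apply: contra_neq vi0 => q0.
  have /eqP : q.[c i0] = 0 by rewrite q0 horner0.
  rewrite horner_sum (bigD1 i0) //= big1 ?addr0 => [|j ji].
    by rewrite hornerZ mulf_eq0 (negPf (L_nz i0)) orbF => /eqP.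
  rewrite hornerZ horner_prod (bigD1 i0) 1?eq_sym //=.
  by rewrite hornerXsubC subrr mul0r mulr0.
have IqG : I (horner_alg 'X_k q * G ^+ N).
  pose W := \prod_j ('X_k - (c j)%:MP) : {mpoly K[n]}.
  have LW i : horner_alg 'X_k (L i) * ('X_k - (c i)%:MP) = W.
    rewrite /W (bigD1 i) //= mulrC rmorph_prod; congr (_ * _).
    apply: eq_bigr => j _; rewrite rmorphB /= horner_algX horner_algC /=.
    by rewrite -mul_mpolyC mulr1.
  have -> : horner_alg 'X_k q * G ^+ N =
      \sum_i v i *: (horner_alg 'X_k (L i) *
               (G ^+ N - (w (c i)).2 * ('X_k - (c i)%:MP))).
    rewrite -[LHS]subr0 -[X in _ - X](mulr0 W) -[X in W * X]uv mulr_sumr.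
    rewrite linear_sum /= mulr_suml.
    rewrite -sumrB; apply: eq_bigr => i _.
    rewrite linearZ /= mulr_algl -scalerAl -scalerAr -scalerBr; congr (_ *: _).
    by rewrite -(LW i); ring.
  apply: ideal_sum => // i; rewrite -mul_mpolyC; do 2!apply: (IM).
  by case: (wB i) => <- _.
have [M] := radical_cancel_poly idI Grad q0 IqG.
by rewrite -exprD => IG; exists (M + N)%N.
Qed.

Theorem nullstellensatz I G : is_ideal I ->
  (forall a : 'I_n -> K, (forall p, I p -> p.@[a] = 0) -> G.@[a] = 0) ->
  radical I G.
Proof.
move=> idI GV; apply: contrapT => nGrad.
have [J [[J0 JD JM] IJ Jx nJ]] : exists J, [/\ is_ideal J, I `<=` J,
    forall i, i \in enum 'I_n -> exists c, J ('X_i - c%:MP) & ~ radical J G].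
  elim: (enum 'I_n) => [|k s [J [idJ IJ Js nJ]]]; first by exists I; split.
  have [c nJc] : exists c, ~ radical (adjoin J ('X_k - c%:MP)) G.
    apply: contrapT => none; apply: nJ; apply: (radical_adjoin (k := k)) => // c.
    by apply: contrapT => nc; apply: none; exists c.
  have JJ p : J p -> adjoin J ('X_k - c%:MP) p.
    by move=> Jp; exists 0; rewrite mul0r subr0.
  exists (adjoin J ('X_k - c%:MP)); split=> //; first exact: is_ideal_adjoin.
    by move=> p /IJ/JJ.
  move=> i; rewrite inE => /predU1P[->|/Js[e Je]]; last by exists e; apply: JJ.
  by exists c, 1; rewrite mul1r subrr; case: idJ.
have /choice[a Ja] i : exists c, J ('X_i - c%:MP) by apply: Jx; rewrite mem_enum.
(* Modulo [J] every variable is a constant, hence so is every polynomial. *)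
have Jeval p : J (p - p.@[a]%:MP).
  elim/mpoly_algebra_ind: p => [c|i|p q Jp Jq|p q Jp Jq].
  - by rewrite mevalC subrr.
  - by rewrite mevalXU.
  - by rewrite mevalD mpolyCD opprD addrACA; apply: JD.
  rewrite mevalM mpolyCM.
  rewrite (_ : _ - _ = q * (p - p.@[a]%:MP) + p.@[a]%:MP * (q - q.@[a]%:MP)).
    by apply: JD; apply: JM.
  by ring.
have J1 : ~ J 1 by move=> /(JM G); rewrite mulr1 => JG; apply: nJ; exists 1%N.
apply: nJ; exists 1%N; have := Jeval G; rewrite GV ?mpolyC0 ?subr0 // => p /IJ Jp.
apply/eqP; apply: contra_notT J1 => pa.
have : J (p.@[a]%:MP).
  have := JD _ _ (JM (-1) _ (Jeval p)) Jp.
  by rewrite mulN1r opprB subrK.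
by move=> /(JM (p.@[a]^-1%:MP)); rewrite -mpolyCM mulVf.
Qed.

End Nullstellensatz.

(** * Cross products and kernels of linear forms in three variables *)

Lemma forall_ord3 (P : 'I_3 -> Prop) : P 0 -> P 1 -> P 2%:R -> forall k, P k.
Proof.
move=> P0 P1 P2 [[|[|[|//]]] lt_k].
- by rewrite (_ : Ordinal _ = 0) //; apply/val_inj.
- by rewrite (_ : Ordinal _ = 1) //; apply/val_inj.
- by rewrite (_ : Ordinal _ = 2%:R) //; apply/val_inj.
Qed.

Lemma sum_ord3 (V : zmodType) (f : 'I_3 -> V) :
  \sum_k f k = f 0 + f 1 + f 2%:R.
Proof.
rewrite !big_ord_recl big_ord0 addr0 addrA.
by congr (f _ + f _ + f _); apply/val_inj.
Qed.

Section CrossProduct.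
Variable K : fieldType.
Implicit Types u v w P Q : 'I_3 -> K.

Definition dot u v : K := \sum_k u k * v k.

(** Index arithmetic is modulo 3, which makes the formula cyclic. *)
Definition cross u v (k : 'I_3) : K :=
  u (k + 1) * v (k + 2%:R) - u (k + 2%:R) * v (k + 1).

Definition proportional u v : Prop := forall j k, u j * v k = u k * v j.

Lemma crossE u v :
  [/\ cross u v 0 = u 1 * v 2%:R - u 2%:R * v 1,
      cross u v 1 = u 2%:R * v 0 - u 0 * v 2%:R
    & cross u v 2%:R = u 0 * v 1 - u 1 * v 0].
Proof.
by split; congr (_ * _ - _ * _); (congr (u _) || congr (v _)); apply/val_inj.
Qed.

Lemma cross_eq0 u v : (forall k, cross u v k = 0) <-> proportional u v.
Proof.
have [c0 c1 c2] := crossE u v; split=> [z j k|uv].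
  have := z 0; have := z 1; have := z 2%:R; rewrite c0 c1 c2.
  move=> /subr0_eq e2 /subr0_eq e1 /subr0_eq e0.
  by elim/forall_ord3: j; elim/forall_ord3: k; rewrite ?(e0, e1, e2).
by move=> k; rewrite /cross uv subrr.
Qed.

Lemma cross_cross u v w k :
  cross u (cross v w) k = v k * dot u w - w k * dot u v.
Proof.
rewrite /dot !sum_ord3.
have [c0 c1 c2] := crossE v w; have [d0 d1 d2] := crossE u (cross v w).
by elim/forall_ord3: k; rewrite !(d0, d1, d2, c0, c1, c2); ring.
Qed.

Lemma dot_cross_same u v : dot u (cross v u) = 0.
Proof.
by rewrite /dot sum_ord3; have [-> -> ->] := crossE v u; ring.
Qed.

Lemma proportional_dot u v w k :
  proportional u v -> v k * dot u w = u k * dot v w.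
Proof.
move=> uv; rewrite /dot !mulr_sumr; apply: eq_bigr => j _.
by rewrite !mulrA [v k * _]mulrC uv.
Qed.

(** Two linear forms killing the same plane, spanned by [P] and [w], are both
    multiples of [cross P w]. *)
Lemma kernel_sub u v P w Q :
  (exists k, u k != 0) -> ~ proportional P w ->
  dot u P = 0 -> dot u w = 0 -> dot v P = 0 -> dot v w = 0 ->
  dot u Q = 0 -> dot v Q = 0.
Proof.
move=> [k uk] nPw uP uw vP vw uQ.
have prop x : dot x P = 0 -> dot x w = 0 -> proportional x (cross P w).
  move=> xP xw; apply/cross_eq0 => l.
  by rewrite cross_cross xP xw !mulr0 subrr.
have [a Na] : exists a, cross P w a != 0.
  apply: contrapT => none; apply/nPw/cross_eq0 => a.
  by apply/eqP; apply: contra_notT none => ?; exists a.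
have NQ : dot (cross P w) Q = 0.
  have := proportional_dot Q k (prop u uP uw); rewrite uQ mulr0 => /esym/eqP.
  by rewrite mulf_eq0 (negPf uk) => /eqP.
have := proportional_dot Q a (prop v vP vw); rewrite NQ mulr0 => /eqP.
by rewrite mulf_eq0 (negPf Na) => /eqP.
Qed.

(** With [e] the basis vector of an index [a] where [P a != 0], the vector
    [cross e u] works, since [cross P (cross e u) = - P a * u] is nonzero. *)
Lemma kernel_direction u P : (exists k, u k != 0) -> (exists k, P k != 0) ->
  dot u P = 0 -> exists2 v, dot u v = 0 & ~ proportional P v.
Proof.
move=> [k uk] [a Pa] uP; pose e (l : 'I_3) : K := (l == a)%:R.
have de x : dot x e = x a.
  rewrite /dot (bigD1 a) //= big1 ?addr0 => [|l /negPf la].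
    by rewrite /e eqxx mulr1.
  by rewrite /e la mulr0.
exists (cross e u); first exact: dot_cross_same.
move=> /cross_eq0 /(_ k) /eqP; rewrite cross_cross de.
rewrite [dot P u](_ : _ = 0) ?mulr0 ?sub0r ?oppr_eq0 ?mulf_eq0.
  by rewrite (negPf uk) (negPf Pa).
by rewrite -uP; apply: eq_bigr => l _; rewrite mulrC.
Qed.

End CrossProduct.

(** * Restriction to a line and order of vanishing *)

Section Line.
Variables (K : fieldType) (n : nat).
Implicit Types (P v : 'I_n -> K) (p q : {mpoly K[n]}) (A : 'I_n -> {mpoly K[n]}).

Definition gradient p P (k : 'I_n) : K := (p^`M(k)).@[P].

(** The univariate polynomial [p(P + 'X v)]. *)
Definition on_line P v p : {poly K} :=
  mmap (@polyC K) (fun k => (P k)%:P + (v k)%:P * 'X) p.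

Lemma on_lineM P v p q : on_line P v (p * q) = on_line P v p * on_line P v q.
Proof. exact: rmorphM. Qed.

Lemma on_lineD P v p q : on_line P v (p + q) = on_line P v p + on_line P v q.
Proof. exact: rmorphD. Qed.

Lemma on_lineX P v i : on_line P v 'X_i = (P i)%:P + (v i)%:P * 'X.
Proof. by rewrite /on_line mmapX mmap1U. Qed.

Lemma on_line0 P v p : (on_line P v p).[0] = p.@[P].
Proof.
elim/mpoly_algebra_ind: p => [c|i|p q Hp Hq|p q Hp Hq].
- by rewrite /on_line mmapC hornerC mevalC.
- by rewrite on_lineX mevalXU !hornerE.
- by rewrite on_lineD mevalD hornerD Hp Hq.
- by rewrite on_lineM mevalM hornerM Hp Hq.
Qed.

Lemma deriv_on_line0 P v p :
  (on_line P v p)^`().[0] = \sum_k gradient p P k * v k.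
Proof.
elim/mpoly_algebra_ind: p => [c|i|p q Hp Hq|p q Hp Hq].
- rewrite /on_line mmapC derivC horner0 big1 // => k _.
  by rewrite /gradient mderivC meval0 mul0r.
- rewrite on_lineX derivD derivC derivM derivC derivX !hornerE /=.
  rewrite (bigD1 i) //= big1 => [|k /negPf ki].
    rewrite /gradient mderivX mnm1E eqxx scale1r.
    rewrite (_ : (U_(i) - U_(i))%MM = 0%MM) ?mpolyX0 ?meval1 ?mul1r ?addr0 //.
    by apply/mnmP => k; rewrite mnmBE subnn mnm0E.
  by rewrite /gradient mderivX mnm1E eq_sym ki scale0r meval0 mul0r.
- rewrite on_lineD derivD hornerD Hp Hq -big_split; apply: eq_bigr => k _.
  by rewrite /gradient mderivD mevalD mulrDl.
- rewrite on_lineM derivM hornerD !hornerM Hp Hq !on_line0.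
  rewrite mulr_suml mulr_sumr -big_split; apply: eq_bigr => k _.
  by rewrite /gradient mderivM mevalD !mevalM /=; ring.
Qed.

Definition derivation A p : {mpoly K[n]} := \sum_k A k * p^`M(k).

Lemma derivationM A p q :
  derivation A (p * q) = derivation A p * q + p * derivation A q.
Proof.
rewrite /derivation mulr_suml mulr_sumr -big_split; apply: eq_bigr => k _.
by rewrite mderivM /=; ring.
Qed.

Lemma derivation1 A : derivation A 1 = 0.
Proof. by rewrite /derivation big1 // => k _; rewrite -mpolyC1 mderivC mulr0. Qed.

Lemma poly_root0 (g : {poly K}) : g.[0] = 0 ->
  exists2 h, g = 'X * h & h.[0] = g^`().[0].
Proof.
move=> /eqP/factor_theorem[h ->]; rewrite subr0; exists h; first by rewrite mulrC.
by rewrite derivM derivX !hornerE ?mulr0 ?add0r.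
Qed.

(** Compare orders of vanishing at [P] along the line in direction [v].  With
    [r] the number of indices [j != i] such that [F j] vanishes at [P], the
    product over [j != i] has order exactly [r], its image under the derivation
    has order at least [r - 1], and [F i] has order at least 2. *)
Lemma derivation_vanishes (T : finType) (F : T -> {mpoly K[n]}) (i : T) A P v :
  derivation A (\prod_j F j) = 0 ->
  (F i).@[P] = 0 -> \sum_k gradient (F i) P k * v k = 0 ->
  (forall j, j != i -> (F j).@[P] = 0 -> \sum_k gradient (F j) P k * v k != 0) ->
  (derivation A (F i)).@[P] = 0.
Proof.
move=> AF FiP Fiv Fjv; pose l := on_line P v.
(* Both facts on the product over [j != i] are stable under products, so
   they only need checking factor by factor; the extra ['X] avoids the
   truncated subtraction [r - 1]. *)
have [r [e [s [Ee e0 Es]]]] : exists r e s,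
    [/\ l (\prod_(j | j != i) F j) = 'X^r * e, e.[0] != 0 &
        'X * l (derivation A (\prod_(j | j != i) F j)) = 'X^r * s].
  elim/big_ind: _ => [|p q|j ji].
  - exists 0%N, 1, 0; rewrite derivation1 /l /on_line mmap0 rmorph1 !mulr0 mulr1.
    by split; rewrite ?hornerC ?oner_neq0.
  - move=> [r1 [e1 [s1 [E1 e10 S1]]]] [r2 [e2 [s2 [E2 e20 S2]]]].
    exists (r1 + r2)%N, (e1 * e2), (s1 * e2 + e1 * s2).
    rewrite hornerM mulf_neq0 // derivationM /l on_lineD !on_lineM -/l.
    rewrite (_ : 'X * _ = 'X * l (derivation A p) * l q
                          + l p * ('X * l (derivation A q))); last by ring.
    by rewrite S1 S2 E1 E2 exprD; split=> //; ring.
  have [FjP|FjP] := eqVneq (F j).@[P] 0.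
    have [h lh h0] : exists2 h, l (F j) = 'X * h & h.[0] = (l (F j))^`().[0].
      by apply: poly_root0; rewrite on_line0.
    exists 1%N, h, (l (derivation A (F j))); rewrite expr1 h0 deriv_on_line0.
    by split=> //; apply: Fjv.
  exists 0%N, (l (F j)), ('X * l (derivation A (F j))).
  by rewrite expr0 !mul1r on_line0.
have [g lg g0] : exists2 h, l (F i) = 'X * h & h.[0] = (l (F i))^`().[0].
  by apply: poly_root0; rewrite on_line0.
have [h gh _] : exists2 h, g = 'X * h & h.[0] = g^`().[0].
  by apply: poly_root0; rewrite g0 deriv_on_line0.
move: AF; rewrite (bigD1 i) //= derivationM => /(congr1 l).
rewrite /l on_lineD !on_lineM -/l [l 0]mmap0 lg gh Ee.
set d := l (derivation A (F i)) => AF.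
have : 'X^r * (d * e + 'X * h * s) = 0.
  rewrite -[RHS]AF (_ : 'X^r * _ = d * ('X^r * e) + 'X * h * ('X^r * s)).
    by rewrite -Es; ring.
  by ring.
move=> /eqP; rewrite mulf_eq0 expf_eq0 polyX_eq0 andbF /= => /eqP.
move=> /(congr1 (horner^~ 0)); rewrite !hornerE => /eqP.
by rewrite mulf_eq0 (negPf e0) orbF on_line0 => /eqP.
Qed.

End Line.

(** * Singular points of a transverse arrangement *)

Lemma homogeneous_prod (A : comNzRingType) (n : nat) (T : finType) (Q : pred T)
    (F : T -> {mpoly A[n]}) :
  (forall i, homogeneous (F i)) -> homogeneous (\prod_(i | Q i) F i).
Proof.
move=> Fh; elim/big_ind: _ => [|p q [d pd] [e qe]|i _]; last exact: Fh.
- by exists 0%N; apply: dhomog1.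
- by exists (d + e)%N; apply: dhomogM.
Qed.

(** A nonzero form of degree 0 is a constant, hence a unit. *)
Lemma irreducible_degree_gt0 (K : fieldType) (n d : nat) (p : {mpoly K[n]}) :
  irreducible_elt p -> p \is d.-homog -> (0 < d)%N.
Proof.
case=> p0 pU _; rewrite lt0n => ph; apply: contraNneq pU => d0.
have pC : p = (p@_0)%:MP.
  apply/mpolyP => m; rewrite mcoeffC.
  have [<-|m0] := eqVneq 0%MM m; first by rewrite mulr1.
  by rewrite mulr0 (dhomog_nemf_coeff ph) // d0 mdeg_eq0 eq_sym.
rewrite pC rmorph_unit // unitfE; apply: contra_neq p0 => c0.
by rewrite pC c0 mpolyC0.
Qed.

Lemma ideal_span_mem (A : nzRingType) (n : nat) (g : 'I_n -> A) k :
  ideal_span g (g k).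
Proof.
exists (fun j => (j == k)%:R); rewrite (bigD1 k) //= eqxx mul1r big1 ?addr0 //.
by move=> j /negPf ->; rewrite mul0r.
Qed.

Section Arrangement.
Variable R : realType.
Local Notation K := R[i].
Implicit Types (p : {mpoly K[3]}) (a : 'I_3 -> K).

Lemma euler_at p d a : p \is d.-homog ->
  dot (gradient p a) a = d%:R * p.@[a].
Proof.
move=> /mpoly_euler /(congr1 (meval a)); rewrite mevalZ => <-.
rewrite [RHS]raddf_sum; apply: eq_bigr => k _.
by rewrite /= mevalM mevalXU mulrC.
Qed.

Variables (m : nat) (F : 'I_m -> {mpoly K[3]}).
Hypothesis Fhomog : forall i, homogeneous (F i).
Hypothesis Fsmooth : forall i, smooth_curve (F i).
Hypothesis Ftransverse : forall i j, i <> j -> transverse (F i) (F j).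

Lemma row_ord0 a : (\row_k a k) ord0 = a.
Proof. by apply/funext => k; rewrite mxE. Qed.

Lemma zero_locus_row p a : (exists k, a k != 0) -> p.@[a] = 0 ->
  zero_locus p (\row_k a k).
Proof.
move=> [k ak] pa; split; last by rewrite row_ord0.
by apply: contra_neq ak => /rowP/(_ k); rewrite !mxE.
Qed.

Lemma smooth_gradient i a : (exists k, a k != 0) -> (F i).@[a] = 0 ->
  exists k, gradient (F i) a k != 0.
Proof.
move=> a0 Fa; have [k] := Fsmooth (zero_locus_row a0 Fa).
by rewrite row_ord0; exists k.
Qed.

Lemma gradient_dot0 i a : (F i).@[a] = 0 -> dot (gradient (F i) a) a = 0.
Proof. by move=> Fa; have [d Fd] := Fhomog i; rewrite (euler_at _ Fd) Fa mulr0. Qed.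

(** If [a] and [w] were independent, both tangent lines at [a] would be the
    line through [a] and [w], against transversality. *)
Lemma common_tangent i j a w : i != j -> (exists k, a k != 0) ->
  (F i).@[a] = 0 -> (F j).@[a] = 0 ->
  dot (gradient (F i) a) w = 0 -> dot (gradient (F j) a) w = 0 ->
  proportional a w.
Proof.
move=> /eqP ij a0 Fi Fj wi wj; apply: contrapT => aw.
apply: (Ftransverse ij (zero_locus_row a0 Fi) (zero_locus_row a0 Fj)).
have dotE l Q : \sum_k ((F l)^`M(k)).@[(\row_k a k) ord0] * Q ord0 k =
    dot (gradient (F l) a) (Q ord0) by rewrite row_ord0.
apply/seteqP; split=> Q [Q0]; rewrite /= !dotE => Qdot; split=> //=;
  rewrite dotE; move: Qdot; apply: kernel_sub aw _ _ _ _ => //;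
  by [exact: smooth_gradient | exact: gradient_dot0].
Qed.

(** At a zero [a != 0] of the gradient of the product at least two curves meet,
    because each curve is smooth; [derivation_vanishes], applied on a line
    tangent to one of them, makes the value of [A] orthogonal to its gradient. *)
Lemma syzygy_at_singular_point A a :
  derivation A (\prod_i F i) = 0 -> (\prod_i F i).@[a] = 0 ->
  (forall k, gradient (\prod_i F i) a k = 0) ->
  proportional a (fun k => (A k).@[a]).
Proof.
move=> AF Fa dF.
have [a0|a0] := pselect (exists k, a k != 0); last first.
  have {}a0 k : a k = 0 by apply/eqP; apply: contra_notT a0 => ?; exists k.
  by move=> j k; rewrite !a0 !mul0r.
have prod0 (Q : pred 'I_m) : (\prod_(i | Q i) F i).@[a] = 0 ->
    exists2 i, Q i & (F i).@[a] = 0.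
  by rewrite rmorph_prod => /eqP/prodf_eq0[i Qi /eqP]; exists i.
have [i _ Fi] := prod0 _ Fa.
have [j ji Fj] : exists2 j, j != i & (F j).@[a] = 0.
  apply: prod0; have [k gk] := smooth_gradient a0 Fi.
  have := dF k; rewrite /gradient (bigD1 i) //= mderivM mevalD !mevalM Fi.
  by rewrite mul0r addr0 => /eqP; rewrite mulf_eq0 (negPf gk) => /eqP.
have A_tangent l : (F l).@[a] = 0 ->
    dot (gradient (F l) a) (fun k => (A k).@[a]) = 0.
  move=> Fl; have [v lv av] :=
    kernel_direction (smooth_gradient a0 Fl) a0 (gradient_dot0 Fl).
  have <- : (derivation A (F l)).@[a] =
      dot (gradient (F l) a) (fun k => (A k).@[a]).
    rewrite [LHS]raddf_sum; apply: eq_bigr => k _.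
    by rewrite /= mevalM mulrC.
  apply: (derivation_vanishes (F := F) (v := v)) => // h hl Fh.
  by apply: contra_notN av => /eqP hv; apply: (@common_tangent h l).
by apply: (@common_tangent j i) => //; apply: A_tangent.
Qed.

End Arrangement.

Theorem proposition3p6 (R : realType) (m : nat) (hm : (2 <= m)%N)
    (F : 'I_m -> {mpoly R[i][3]})
    (Fhomog : forall i, homogeneous (F i))
    (Firr : forall i, irreducible_elt (F i))
    (Fsmooth : forall i, smooth_curve (F i))
    (Fdistinct : forall i j, i <> j -> zero_locus (F i) <> zero_locus (F j))
    (Ftransverse : forall i j, i <> j -> transverse (F i) (F j)) :
  (alpha (radical (jacobian_ideal (\prod_(i < m) F i)))
     <= beta (\prod_(i < m) F i) + 1)%N.
Proof.
set G := \prod_(i < m) F i.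
have G0 : G != 0 by apply/prodf_neq0 => i _; case: (Firr i).
have [e e_gt0 Ge] : exists2 e, (0 < e)%N & G \is e.-homog.
  pose i0 := Ordinal (ltnW hm); have [d Fd] := Fhomog i0.
  have [f Ef] := homogeneous_prod (fun i => i != i0) Fhomog.
  exists (d + f)%N.
    by rewrite addn_gt0 (irreducible_degree_gt0 (Firr i0) Fd).
  by rewrite /G (bigD1 i0) //=; apply: dhomogM.
have eK : e%:R != 0 :> R[i] by rewrite pnatr_eq0 -lt0n.
have [[A [[k0 Ak0] Ad AG]] _] :
    syzygy_degrees G (beta G) /\ _ :=
  leastP (syzygy_degrees_neq0 (ex_intro _ e Ge)).
(* These minors are the wanted elements of the radical. *)
pose M j k := 'X_j * A k - 'X_k * A j.
have [j [k Mjk]] : exists j k, M j k != 0.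
  apply: contrapT => none.
  have M0 j k : 'X_j * A k = 'X_k * A j.
    by apply: subr0_eq; apply/eqP; apply: contra_notT none => ?; exists j, k.
  (* Euler's formula: [e F A_k0] equals ['X_k0] times the syzygy relation. *)
  have : A k0 * (e%:R *: G) = 0.
    rewrite -(mpoly_euler Ge) mulr_sumr -[RHS](mulr0 'X_k0) -[X in _ * X]AG.
    rewrite mulr_sumr; apply: eq_bigr => k _.
    by rewrite !mulrA [A k0 * _]mulrC M0.
  by move=> /eqP; rewrite mulf_eq0 (negPf Ak0) scaler_eq0 (negPf eK) (negPf G0).
suff radM : radical (jacobian_ideal G) (M j k).
  have Mdeg : degrees (radical (jacobian_ideal G)) (beta G + 1)%N.
    exists (M j k); split=> //; rewrite addnC.
    by rewrite rpredB // dhomogM // dhomogX /= mdeg1.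
  by have [_] := leastP (ex_intro _ _ Mdeg); apply.
apply: nullstellensatz; first exact: complex_uncountable.
  exact: is_ideal_span.
move=> a Ja; have dG l : gradient G a l = 0.
  exact/Ja/(ideal_span_mem (fun l : 'I_3 => G^`M(l))).
have Ga : G.@[a] = 0.
  apply/eqP; rewrite -(mulrI_eq0 _ (mulfI eK)) -(euler_at _ Ge).
  by apply/eqP/big1 => l _; rewrite dG mul0r.
rewrite mevalB !mevalM !mevalXU; apply/eqP; rewrite subr_eq0; apply/eqP.
exact: (syzygy_at_singular_point Fhomog Fsmooth Ftransverse AG Ga dG).
Qed.
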